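(* Let $\langle R,\sim\rangle$ be the Rado graph, $A\in\mathbb P(R)$, and let $\mathcal D=\langle\mathcal D_n:n\in\omega\rangle$ be a sequence of subsets of $\mathbb P(R)$ each of which is dense below $A$. Then the set $\mathcal F=\{L: L\text{ is a fusion of }\mathcal D\}$ is dense below $A$ (i.e., for every $B\in\mathbb P(R)$ with $B\subset A$ there is $L\in\mathcal F$ with $L\subset B$).
   Context: The Rado graph $\langle R,\sim\rangle$ is the unique countable graph such that $R^H_K\neq\emptyset$ for all finite $K\subset H\subset R$, where $R^H_K=\{v\in R\setminus H:\forall k\in K\,(v\sim k)\wedge\forall h\in H\setminus K\,(v\not\sim h)\}$; for $L\subset R$, $L^H_K=L\cap R^H_K$. $\mathbb P(R)$ is the set of subsets of $R$ whose induced subgraph is isomorphic to $R$, ordered by inclusion; a set $\mathcal D\subset\mathbb P(R)$ is dense below $A$ iff every $B\in\mathbb P(R)$ with $B\subset A$ contains some element of $\mathcal D$. A labeling of $L\in\mathbb P(R)$ is a pair consisting of a partition $\{L_n:n\in\omega\}$ of $L$ and a bijection $(n,K)\mapsto q^{\bigcup_{i<n}L_i}_K$ from $\bigcup_n\{n\}\times P(\bigcup_{i<n}L_i)$ onto $L$ such that $L_n=\{q^{\bigcup_{i<n}L_i}_K:K\subset\bigcup_{i<n}L_i\}$ and $q^{\bigcup_{i<n}L_i}_K\in L^{\bigcup_{i<n}L_i}_K$. A copy $L\in\mathbb P(R)$ is a fusion of a sequence $\langle\mathcal D_n:n\in\omega\rangle$ of subsets of $\mathbb P(R)$ iff $L$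 has a labeling such that for every $n\in\omega$ and every $K\subset\bigcup_{i<n}L_i$ there is $D\in\mathcal D_n$ with $L^{\bigcup_{i<n}L_i}_K\subset D$. *)

(* Defs.v *)
From mathcomp Require Import all_boot.
From mathcomp Require Import boolp classical_sets functions cardinality.

Set Implicit Arguments.
Unset Strict Implicit.
Unset Printing Implicit Defensive.

Local Open Scope classical_set_scope.

(* R^H_K, where R is the whole type T *)
Definition ext_set (T : Type) (sim : T -> T -> Prop) (H K : set T) : set T :=
  [set v | [/\ ~ H v, forall k, K k -> sim v k
             & forall h, (H `\` K) h -> ~ sim v h]].

Record rado_graph (T : Type) (sim : T -> T -> Prop) : Prop := RadoGraph {
  rado_sym : forall x y, sim x y -> sim y x;
  rado_irrefl : forall x, ~ sim x x;
  rado_countable : countable [set: T];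
  rado_ext : forall H K : set T,
    finite_set H -> K `<=` H -> ext_set sim H K !=set0
}.

(* P(R): the bijection f is an isomorphism from the whole graph onto the
   subgraph induced on L. *)
Definition copies (T : Type) (sim : T -> T -> Prop) : set (set T) :=
  [set L | exists f : T -> T, set_bij [set: T] L f /\
             forall x y, sim x y <-> sim (f x) (f y)].

Definition dense_below (T : Type) (sim : T -> T -> Prop) (A : set T)
    (D : set (set T)) : Prop :=
  forall B, copies sim B -> B `<=` A -> exists2 C, D C & C `<=` B.

Definition below (T : Type) (Ls : nat -> set T) (n : nat) : set T :=
  \bigcup_(i in [set i | (i < n)%N]) Ls i.

(* [q n K] is the vertex labeled by (n, K); it is meaningful only for
   K `<=` below Ls n. *)
Record labeling (T : Type) (sim : T -> T -> Prop) (L : set T)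
    (Ls : nat -> set T) (q : nat -> set T -> T) : Prop := Labeling {
  labeling_partition : partition [set: nat] Ls L;
  labeling_bij : set_bij [set p : nat * set T | p.2 `<=` below Ls p.1] L
                   (fun p => q p.1 p.2);
  labeling_level : forall n, Ls n = [set q n K | K in [set K | K `<=` below Ls n]];
  labeling_ext : forall n K, K `<=` below Ls n ->
    (L `&` ext_set sim (below Ls n) K) (q n K)
}.

Definition fusion (T : Type) (sim : T -> T -> Prop)
    (D : nat -> set (set T)) (L : set T) : Prop :=
  copies sim L /\
  exists (Ls : nat -> set T) (q : nat -> set T -> T),
    labeling sim L Ls q /\
    forall n K, K `<=` below Ls n ->
      exists2 C, D n C & L `&` ext_set sim (below Ls n) K `<=` C.

(* Main.v *)
Require Import Defs.
From mathcomp Require Import all_boot finmap.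
From mathcomp Require Import boolp classical_sets functions cardinality.

Local Open Scope classical_set_scope.

(** Fix a labeling of the whole graph, with finite initial segments [F n].  A
    sequence of embeddings [phi n] of the Rado graph into itself is built such
    that [phi n.+1] agrees with [phi n] on [F n], has a smaller range, and sends
    each [ext_set sim (F n) K] into a member of [D n].  The limit of the [phi n]
    is an embedding with the same properties, and the image of the labeling
    under it witnesses that its range is a fusion.

    The difficulty is to shrink all the sets [ext_set sim F K], [K `<=` F], into
    members of [D n] while keeping their mutual position generic.  To this end,
    universality of the Rado graph provides "twin" copies [x K] of the graph
    inside the sets [ext_set sim F K], such that [x K c] is adjacent to
    [x K' c'] iff [c] is adjacent to [c'].  Composing with an embedding shrinks
    all the twin copies simultaneously, so finitely many applications of density
    bring each [x K] into a member of [D n].  Fixing [F] pointwise and sending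
    [u] outside [F] to [x K u], where [K] is the neighborhood of [u] in [F], is
    then an embedding again. *)

Section Preliminaries.
Set Implicit Arguments.
Unset Strict Implicit.

Lemma subset_image (U W : Type) (f : U -> W) (A : set U) (B : set W) :
  B `<=` f @` A -> exists2 C, C `<=` A & f @` C = B.
Proof.
move=> BfA; exists (A `&` f @^-1` B); first exact: subIsetl.
apply/seteqP; split=> [_ [t [_ Bft] <-]//|y By].
by have [t At ft] := BfA _ By; exists t => //; split; rewrite //= ft.
Qed.

Lemma finite_set_ind (I : Type) (P : set I -> Prop) :
  P set0 -> (forall i S, P S -> P (i |` S)) ->
  forall S, finite_set S -> P S.
Proof.
move=> P0 PU S /(@finite_seqP {classic I})[s ->].
elim: s => [|i s Ps]; first by rewrite set_nil.
suff -> : [set` i :: s] = i |` [set` s] by exact: PU.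
by apply/seteqP; split=> j /=; rewrite inE => /predU1P.
Qed.

Lemma finite_powerset (T : Type) (F : set T) :
  finite_set F -> finite_set [set K | K `<=` F].
Proof.
move=> /(@finite_fsetP {classic T})[X ->].
apply: sub_finite_set (finite_image (fun Y : {fset {classic T}} => [set` Y])
  (finite_fset (fpowerset X))) => K /= KX.
have /finite_fsetP[Y KE] := finite_subfset X KX.
exists Y => //; rewrite /= fpowersetE; apply/fsubsetP => t.
by have := KX t; rewrite KE.
Qed.

Lemma dependent_choice_inv (X : Type) (P : X -> Prop)
    (R : nat -> X -> X -> Prop) (x0 : X) :
  P x0 -> (forall n x, P x -> exists2 y, P y & R n x y) ->
  exists2 u : nat -> X, u 0%N = x0 & forall n, P (u n) /\ R n (u n) (u n.+1).
Proof.
move=> Px0 step.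
have /choice[next nextP] (p : nat * X) :
    exists y, P p.2 -> P y /\ R p.1 p.2 y.
  have [/(step p.1)[y Py Ry]|nP] := pselect (P p.2); first by exists y.
  by exists p.2.
pose u := fix u n := if n is m.+1 then next (m, u m) else x0.
have Pu n : P (u n) by elim: n => // n /(nextP (n, u n))[].
by exists u => // n; split=> //; have [] := nextP (n, u n) (Pu n).
Qed.

Lemma stable_limit (U W : Type) (F : nat -> set U) (f : nat -> U -> W) :
  {homo F : m n / (m <= n)%N >-> m `<=` n} -> \bigcup_n F n = setT ->
  (forall n, {in F n, f n.+1 =1 f n}) ->
  exists g : U -> W, forall n, {in F n, g =1 f n}.
Proof.
move=> Fmono Fcover fS.
have f_stable m n t : (m <= n)%N -> F m t -> f n t = f m t.
  move=> + Fmt; elim: n => [|n IHn]; first by rewrite leqn0 => /eqP->.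
  rewrite leq_eqVlt => /predU1P[->//|le_mn].
  by rewrite fS ?IHn //; apply/mem_set; exact: Fmono Fmt.
have /choice[rank rankP] (t : U) : exists n, F n t.
  by have [n _ Fnt] : (\bigcup_n F n) t; [rewrite Fcover|exists n].
exists (fun t => f (rank t) t) => n t /set_mem Fnt.
have [le|/ltnW le] := leqP (rank t) n; last exact: f_stable.
by rewrite (f_stable _ _ _ le (rankP t)).
Qed.

End Preliminaries.

Section ExtSet.
Set Implicit Arguments.
Unset Strict Implicit.
Context {T : Type} (sim : T -> T -> Prop).
Implicit Types (F H K : set T).

Lemma ext_set_adj H K v h : ext_set sim H K v -> H h -> sim v h <-> K h.
Proof.
move=> [_ vK vH] Hh; split=> [vh|]; last exact: vK.
by apply: contrapT => nKh; exact: (vH h).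
Qed.

Lemma ext_setP H K v :
  K `<=` H -> ext_set sim H K v <-> ~ H v /\ H `&` sim v = K.
Proof.
move=> KH; split=> [extv|[nHv <-]]; last first.
  by split=> // [k []//|h [Hh nh] vh]; apply: nh.
split; first by case: extv.
apply/seteqP; split=> [h [Hh /(ext_set_adj extv Hh)]//|h Kh].
by split; [exact: KH|exact/(ext_set_adj extv (KH _ Kh))].
Qed.

Lemma ext_set_inj H K K' v : K `<=` H -> K' `<=` H ->
  ext_set sim H K v -> ext_set sim H K' v -> K = K'.
Proof. by move=> KH K'H /(ext_setP _ KH)[_ <-] /(ext_setP _ K'H)[_ <-]. Qed.

Lemma sub_ext_set F H K v :
  F `<=` H -> ext_set sim H K v -> ext_set sim F (F `&` K) v.
Proof.
move=> FH extv; have [nHv _ _] := extv.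
split=> [/FH//|h [Fh] /(ext_set_adj extv (FH _ Fh))//|h [Fh nKh]].
by move/(ext_set_adj extv (FH _ Fh)) => Kh; apply: nKh.
Qed.

End ExtSet.

Section Labeling.
Set Implicit Arguments.
Unset Strict Implicit.
Context {T : Type} (sim : T -> T -> Prop).
Implicit Types (Ls : nat -> set T) (q : nat -> set T -> T).

Lemma below0 Ls : below Ls 0 = set0.
Proof. by rewrite /below bigcup_mkord big_ord0. Qed.

Lemma belowS Ls n : below Ls n.+1 = below Ls n `|` Ls n.
Proof. by rewrite /below !bigcup_mkord big_ord_recr. Qed.

Lemma subset_below Ls : {homo below Ls : m n / (m <= n)%N >-> m `<=` n}.
Proof.
apply: homo_leq => [F|G F H|n]; [exact: subset_refl|exact: subset_trans|].
by rewrite belowS; exact: subsetUl.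
Qed.

Lemma bigcup_below Ls : \bigcup_n below Ls n = \bigcup_n Ls n.
Proof.
apply/seteqP; split=> [t [n _ [i _ Lit]]|t [n _ Lnt]]; first by exists i.
by exists n.+1 => //; rewrite belowS; right.
Qed.

Lemma labeling_bigcup Ls q :
  (forall n, Ls n = [set q n K | K in [set K | K `<=` below Ls n]]) ->
  (forall n K, K `<=` below Ls n -> ext_set sim (below Ls n) K (q n K)) ->
  labeling sim (\bigcup_n Ls n) Ls q.
Proof.
move=> levelE extq.
have Lq n K : K `<=` below Ls n -> Ls n (q n K).
  by move=> KF; rewrite levelE; exists K.
have disjoint i j t : (i < j)%N -> Ls i t -> ~ Ls j t.
  move=> lt_ij Lit; rewrite levelE => -[K KF qt].
  by have [+ _ _] := extq _ _ KF; rewrite qt; apply; exists i.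
have level_inj i j t : Ls i t -> Ls j t -> i = j.
  move=> Lit Ljt; have [lt|lt|//] := ltngtP i j.
    by case: (disjoint _ _ _ lt Lit).
  by case: (disjoint _ _ _ lt Ljt).
split=> //.
- split=> // [i j _ _ [t [Lit Ljt]]|i _]; first exact: level_inj Lit Ljt.
  by exists (q i set0); exact: Lq.
- split=> [[n K] /= KF|[n K] [m K'] /=|t [n _]].
  + by exists n => //; exact: Lq.
  + rewrite !inE /= => KF K'F qE.
    have nm : n = m by apply: (level_inj _ _ (q n K)); [|rewrite qE]; exact: Lq.
    rewrite -nm in K'F qE *; congr (_, _).
    by apply: (ext_set_inj KF K'F (extq _ _ KF)); rewrite qE; exact: extq.
  + by rewrite levelE => -[K KF <-]; exists (n, K).
- move=> n K KF; split; last exact: extq.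
  by exists n => //; exact: Lq.
Qed.

End Labeling.

Section Embedding.
Set Implicit Arguments.
Unset Strict Implicit.
Context {T : Type} (sim : T -> T -> Prop).
Implicit Types (A C F H K : set T) (f g : T -> T) (D : set (set T)).

Definition embedding f : Prop :=
  injective f /\ forall x y, sim x y <-> sim (f x) (f y).

Lemma embedding_id : embedding id.
Proof. by split=> // x y. Qed.

Lemma embedding_comp f g :
  embedding f -> embedding g -> embedding (f \o g).
Proof.
move=> [fI fE] [gI gE]; split=> [|x y /=]; first exact: inj_comp.
by rewrite gE.
Qed.

Lemma copies_range f : embedding f -> copies sim (range f).
Proof. by move=> [fI fE]; exists f; split=> //; split=> // x y _ _ /fI. Qed.

Lemma copies_embedding C :
  copies sim C -> exists2 f, embedding f & range f = C.
Proof.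
move=> [f [[fC fI fS] fE]]; exists f.
  by split=> // x y; apply: fI; rewrite inE.
by apply/seteqP; split=> // x [y _ <-]; exact: fC.
Qed.

Lemma embedding_factor f g : embedding f -> embedding g ->
  range g `<=` range f -> exists2 k, embedding k & f \o k = g.
Proof.
move=> [fI fE] [gI gE] gf.
have /choice[k kP] (u : T) : exists t, f t = g u.
  by have [t _] := gf (g u) (imageT g u); exists t.
exists k; last exact/funext.
split=> [x y kxy|x y]; first by apply: gI; rewrite -!kP kxy.
by rewrite gE -!kP -fE.
Qed.

Lemma embedding_ext_set f H K v : embedding f ->
  ext_set sim (f @` H) (f @` K) (f v) <-> ext_set sim H K v.
Proof.
move=> [fI fE].
have imE S u : (f @` S) (f u) <-> S u.
  by split=> [[s Ss /fI <-]//|Su]; exists u.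
split=> -[nHv vK vH]; split.
- by move=> /imE.
- by move=> k Kk; apply/fE/vK/imE.
- by move=> h [Hh nKh]; rewrite fE; apply: vH; split; rewrite imE.
- by move=> /imE.
- by move=> _ [k Kk <-]; rewrite -fE; exact: vK.
- by move=> _ [[h Hh <-] nKh]; rewrite -fE; apply: vH; split=> // /imE.
Qed.

Lemma labeling_image f Ls q : embedding f -> labeling sim setT Ls q ->
  labeling sim (range f) (fun n => f @` Ls n) (fun n K => f (q n (f @^-1` K))).
Proof.
move=> femb [[<- _ _] _ levelE extq]; have [fI _] := femb.
have belowE n : below (fun n => f @` Ls n) n = f @` below Ls n.
  by rewrite /below image_bigcup.
have preimageK K : f @^-1` (f @` K) = K.
  by apply/seteqP; split=> [t [u Ku /fI <-]//|t]; exact: imageP.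
rewrite /cover image_bigcup; apply: labeling_bigcup => [n|n K].
  rewrite belowE {1}levelE image_comp.
  apply/seteqP; split=> _ [K KF <-].
    by exists (f @` K); [exact: image_subset|rewrite /= preimageK].
  by exists (f @^-1` K) => // t /KF [u Fu /fI <-].
rewrite belowE => /subset_image[K0 K0F <-]; rewrite preimageK.
by apply/embedding_ext_set => //; exact: (extq _ _ K0F).2.
Qed.

Definition refines F g f : Prop :=
  [/\ embedding g, {in F, g =1 f} & range g `<=` range f].

Lemma sub_refines F H g f : F `<=` H -> refines H g f -> refines F g f.
Proof. by move=> FH [gemb gf gr]; split=> // t /set_mem/FH/mem_set/gf. Qed.

Lemma refines_limit (F : nat -> set T) (f : nat -> T -> T) :
  {homo F : m n / (m <= n)%N >-> m `<=` n} -> \bigcup_n F n = setT ->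
  embedding (f 0%N) -> (forall n, refines (F n) (f n.+1) (f n)) ->
  exists g, forall n, refines (F n) g (f n).
Proof.
move=> Fmono Fcover f0emb fS.
have f_emb n : embedding (f n) by case: n => // n; have [] := fS n.
have f_range : {homo f : m n / (m <= n)%N >-> range n `<=` range m}.
  apply: homo_leq => [h|h k l hk kl|n]; last by have [] := fS n.
    exact: subset_refl.
  exact: subset_trans kl hk.
have [|g gf] := stable_limit Fmono Fcover (f := f).
  by move=> n; have [] := fS n.
have gE n t : F n t -> g t = f n t by move=> /mem_set/gf.
have rank t : exists n, F n t.
  by have [n _ Fnt] : (\bigcup_n F n) t; [rewrite Fcover|exists n].
exists g => n; split=> // [|_ [t _ <-]].
  have common t u : exists n, g t = f n t /\ g u = f n u.
    have [[m Fmt] [k Fku]] := (rank t, rank u).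
    exists (maxn m k); split; apply: gE.
      by apply: Fmono Fmt; exact: leq_maxl.
    by apply: Fmono Fku; exact: leq_maxr.
  split=> t u; have [k [-> ->]] := common t u; have [fI fE] := f_emb k.
    exact: fI.
  exact: fE.
have [m Fmt] := rank t.
rewrite (gE (maxn m n)); last by apply: Fmono Fmt; exact: leq_maxl.
by apply: (f_range _ _ (leq_maxr m n)); exact: imageT.
Qed.

Definition captured D F f : Prop :=
  forall K, K `<=` F -> exists2 C, D C & f @` ext_set sim F K `<=` C.

(* If [g v = f u] then [u] and [v] are joined to the same points of [F], since
   [f] and [g] agree there: hence [g] maps [ext_set sim F K] into its image
   under [f]. *)
Lemma captured_refines D F g f :
  embedding f -> refines F g f -> captured D F f -> captured D F g.
Proof.
move=> femb [gemb gf gr] fD K KF; have [C DC fC] := fD K KF.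
exists C => // _ [v extv <-]; have [u _ fu] := gr _ (imageT g v).
rewrite -fu; apply/fC/imageP.
have gfE S : S `<=` F -> g @` S = f @` S.
  by move=> SF; apply: eq_imagel => t /SF/mem_set/gf.
by apply/(embedding_ext_set _ _ _ femb); rewrite fu -!gfE //;
  apply/embedding_ext_set.
Qed.

Lemma fusion_range (D : nat -> set (set T)) Ls q f :
  labeling sim setT Ls q -> embedding f ->
  (forall n, captured (D n) (below Ls n) f) -> fusion sim D (range f).
Proof.
move=> labT femb fD; split; first exact: copies_range.
do 2 eexists; split; first exact: (labeling_image femb labT).
move=> n K; rewrite /below -image_bigcup -/(below _ n).
move=> /subset_image[K0 K0F <-]; have [C DC fC] := fD n K0 K0F.
exists C => // _ [[t _ <-] /(embedding_ext_set _ _ _ femb) extt].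
exact/fC/imageP.
Qed.

Lemma dense_below_embedding A D f :
  D `<=` copies sim -> dense_below sim A D -> embedding f -> range f `<=` A ->
  exists2 g, embedding g & D (range (f \o g)).
Proof.
move=> Dcopies Ddense femb fA.
have [C DC Cf] := Ddense _ (copies_range femb) fA.
have [h hemb hC] := copies_embedding (Dcopies _ DC).
have [|g gemb fg] := embedding_factor femb hemb; first by rewrite hC.
by exists g; rewrite // fg hC.
Qed.

Lemma dense_below_embeddings A D (I : Type) (S : set I) (f : I -> T -> T) :
  D `<=` copies sim -> dense_below sim A D -> finite_set S ->
  (forall i, S i -> embedding (f i) /\ range (f i) `<=` A) ->
  exists2 g, embedding g &
    forall i, S i -> exists2 C, D C & range (f i \o g) `<=` C.
Proof.
move=> Dcopies Ddense; move: S; apply: finite_set_ind => [_|i S IHS fP].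
  by exists id => //; exact: embedding_id.
have [j Sj|g gemb gD] := IHS; first by apply: fP; right.
have [fiemb fiA] := fP i (or_introl erefl).
have [||h hemb hD] := dense_below_embedding Dcopies Ddense (f := f i \o g).
- exact: embedding_comp.
- by move=> _ [t _ <-]; apply/fiA/imageT.
exists (g \o h) => [|j [->|/gD[C DC gC]]]; first exact: embedding_comp.
  by exists (range (f i \o g \o h)).
by exists C => // _ [t _ <-]; apply: gC; exact: imageT.
Qed.

End Embedding.

Section Twins.
Set Implicit Arguments.
Unset Strict Implicit.
Context {T : Type} (sim : T -> T -> Prop).
Implicit Types (F K : set T) (x : set T -> T -> T).

Definition twins F x : Prop :=
  (forall K c, K `<=` F -> ext_set sim F K (x K c)) /\
  (forall K K' c c', K `<=` F -> K' `<=` F ->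
     (x K c = x K' c' -> c = c') /\ (sim (x K c) (x K' c') <-> sim c c')).

Lemma twins_embedding F x K : twins F x -> K `<=` F -> embedding sim (x K).
Proof.
move=> [_ xtwin] KF.
by split=> c c'; have [xI xE] := xtwin K K c c' KF KF; [exact: xI|rewrite xE].
Qed.

Lemma twins_comp F x f :
  twins F x -> embedding sim f -> twins F (fun K => x K \o f).
Proof.
move=> [xext xtwin] [fI fE].
split=> [K c KF|K K' c c' KF K'F]; first exact: xext.
have [xI xE] := xtwin K K' (f c) (f c') KF K'F.
by split=> [/xI/fI|] //; rewrite (fE c).
Qed.

Definition glue F x u : T := if `[< F u >] then u else x (F `&` sim u) u.

Lemma glue_id F x u : F u -> glue F x u = u.
Proof. by rewrite /glue; case: asboolP. Qed.

Lemma glue_ext F x K u :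
  K `<=` F -> ext_set sim F K u -> glue F x u = x K u.
Proof.
by move=> KF /(ext_setP _ _ KF)[nFu <-]; rewrite /glue; case: asboolP.
Qed.

Lemma glue_embedding F x : (forall u v, sim u v -> sim v u) ->
  twins F x -> embedding sim (glue F x).
Proof.
move=> sym [xext xtwin].
have symE u v : sim u v <-> sim v u by split; exact: sym.
have NF u : F `&` sim u `<=` F by exact: subIsetl.
have glueN u : ~ F u -> glue F x u = x (F `&` sim u) u.
  by rewrite /glue; case: asboolP.
have mixed u v : F u -> ~ F v ->
    glue F x u <> glue F x v /\ (sim (glue F x v) (glue F x u) <-> sim v u).
  move=> Fu nFv; rewrite glue_id // glueN //; have extv := xext _ v (NF v).
  split; first by move=> uE; have [+ _ _] := extv; rewrite -uE.
  by apply: (iff_trans (ext_set_adj extv Fu)); split=> [[]|].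
split=> u v; have [Fu|nFu] := pselect (F u); have [Fv|nFv] := pselect (F v).
- by rewrite !glue_id.
- by have [ne _] := mixed u v Fu nFv => /ne.
- by have [ne _] := mixed v u Fv nFu => /esym/ne.
- by rewrite !glueN //; have [xI _] := xtwin _ _ u v (NF u) (NF v) => /xI.
- by rewrite !glue_id.
- by rewrite symE [X in _ <-> X]symE; have [_ ->] := mixed u v Fu nFv.
- by have [_ ->] := mixed v u Fv nFu.
- by rewrite !glueN //; have [_ ->] := xtwin _ _ u v (NF u) (NF v).
Qed.

End Twins.

Section Rado.
Set Implicit Arguments.
Unset Strict Implicit.
Context {T : Type} (sim : T -> T -> Prop) (rado : rado_graph sim).
Implicit Types (A F K : set T) (D : set (set T)).

Lemma rado_nonempty : [set: T] !=set0.
Proof.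
by have [v _] := rado_ext rado (finite_set0 T) (@subset_refl _ set0); exists v.
Qed.

Lemma rado_enum : exists e : nat -> T, range e = setT.
Proof.
have /pfcard_geP[T0|[e]] := rado_countable rado.
  by have := rado_nonempty; rewrite T0 => -[].
exists e; apply/seteqP; split=> // t _.
by have [n _ <-] := 'surj_e (I : setT t); exists n.
Qed.

Lemma rado_level F t : finite_set F -> exists q : set T -> T,
  (forall K, K `<=` F -> ext_set sim F K (q K)) /\
  (F `|` [set q K | K in [set K | K `<=` F]]) t.
Proof.
move=> finF.
have /choice[q qP] (K : set T) : exists v,
    K `<=` F -> ext_set sim F K v /\ (ext_set sim F K t -> v = t).
  have [extt|nextt] := pselect (ext_set sim F K t); first by exists t.
  have [KF|nKF] := pselect (K `<=` F); last by exists t.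
  by have [v extv] := rado_ext rado finF KF; exists v.
exists q; split=> [K /qP[]//|]; have [Ft|nFt] := pselect (F t); [by left|right].
have NF : F `&` sim t `<=` F by exact: subIsetl.
by exists (F `&` sim t) => //; have [_] := qP _ NF; apply; apply/ext_setP.
Qed.

Lemma rado_labeling : exists Ls q,
  labeling sim setT Ls q /\ forall n, finite_set (below Ls n).
Proof.
have [e eT] := rado_enum.
have [n F finF|F F0 FP] := dependent_choice_inv (P := @finite_set T)
    (R := fun n F F' => exists q : set T -> T,
      [/\ forall K, K `<=` F -> ext_set sim F K (q K),
          F' = F `|` [set q K | K in [set K | K `<=` F]] & F' (e n)])
    (finite_set0 T).
  have [q [extq Fe]] := rado_level (e n) finF.
  exists (F `|` [set q K | K in [set K | K `<=` F]]); last by exists q.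
  by rewrite finite_setU; split=> //; exact/finite_image/finite_powerset.
have /choice[q qP] n := (FP n).2.
pose Ls n := [set q n K | K in [set K | K `<=` F n]].
have belowE n : below Ls n = F n.
  by elim: n => [|n IHn]; rewrite ?below0 // belowS IHn; have [_ -> _] := qP n.
exists Ls, q; split=> [|n]; last by rewrite belowE; have [] := FP n.
suff <- : \bigcup_n Ls n = setT.
  apply: labeling_bigcup => [n|n K]; rewrite belowE //.
  by have [extq _ _] := qP n; exact: extq.
rewrite -bigcup_below -subTset => t _.
have [n _ <-] : range e t by rewrite eT.
by exists n.+1 => //; rewrite belowE; have [] := qP n.
Qed.

Lemma rado_sequence F (N : nat -> set T) (adj : nat -> nat -> Prop) :
  finite_set F -> (forall n, N n `<=` F) -> exists y : nat -> T, forall n,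
    ext_set sim (F `|` y @` `I_n) (N n `|` y @` (`I_n `&` adj n)) (y n).
Proof.
move=> finF NF; have [v _] := rado_nonempty.
pose good n (y : nat -> T) t :=
  ext_set sim (F `|` y @` `I_n) (N n `|` y @` (`I_n `&` adj n)) t.
have [//|n y _|f _ fP] := dependent_choice_inv (P := fun=> True)
    (R := fun n (y z : nat -> T) => {in `I_n, z =1 y} /\ good n y (z n))
    (x0 := fun=> v).
  have [||t yt] := @rado_ext _ _ rado (F `|` y @` `I_n)
    (N n `|` y @` (`I_n `&` adj n)).
  - by rewrite finite_setU; split=> //; exact/finite_image/finite_II.
  - by apply: setUSS => //; apply: image_subset; exact: subIsetl.
  exists (fun i => if (i < n)%N then y i else t) => //; rewrite ltnn.
  by split=> // i; rewrite inE /= => ->.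
have [|||y yP] := stable_limit (F := fun n => `I_n) (f := f).
- by move=> m n le_mn i /= lt_im; exact: leq_trans le_mn.
- by rewrite -subTset => n _; exists n.+1 => //=.
- by move=> n; have [_ []] := fP n.
exists y => n; have [_ [_]] := fP n; rewrite /good.
have yE S : S `<=` `I_n -> f n @` S = y @` S.
  by move=> SI; apply: eq_imagel => i /SI/mem_set/yP.
by rewrite !yE // -(yP n.+1 n) //; apply/mem_set => /=.
Qed.

Lemma rado_universal_nat F (N : nat -> set T) (adj : nat -> nat -> Prop) :
  (forall i, ~ adj i i) -> (forall i j, adj i j -> adj j i) ->
  finite_set F -> (forall n, N n `<=` F) ->
  exists y : nat -> T, [/\ forall n, ext_set sim F (N n) (y n),
    injective y & forall i j, sim (y i) (y j) <-> adj i j].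
Proof.
move=> irrefl sym finF NF; have [y yP] := rado_sequence adj finF NF.
have nFy n : ~ F (y n) by have [+ _ _] := yP n => + Fy; apply; left.
have lt_neq i n : (i < n)%N -> y i <> y n.
  by move=> lt_in yE; have [+ _ _] := yP n; apply; right; exists i.
have yI : injective y.
  move=> i j yE; have [lt|lt|//] := ltngtP i j.
    by case: (lt_neq _ _ lt).
  by case: (lt_neq _ _ lt).
have lt_adj i n : (i < n)%N -> sim (y n) (y i) <-> adj n i.
  move=> lt_in; have yi : (F `|` y @` `I_n) (y i) by right; exists i.
  apply: (iff_trans (ext_set_adj (yP n) yi)); split=> [[/NF/nFy//|]|adj_ni].
    by move=> [j [_ adj_nj] /yI <-].
  by right; exists i.
have symE u v : sim u v <-> sim v u by split; exact: (rado_sym rado).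
exists y; split=> // [n|i j]; last first.
  have [lt|lt|->] := ltngtP i j; last by split=> [/(rado_irrefl rado)|/irrefl].
    by rewrite symE lt_adj //; split; exact: sym.
  exact: lt_adj.
have := sub_ext_set (@subsetUl _ F _) (yP n); rewrite setIUr (setIidr (NF n)).
suff -> : F `&` y @` (`I_n `&` adj n) = set0 by rewrite setU0.
by rewrite -subset0 => t [Ft [j _ yj]]; apply: (nFy j); rewrite yj.
Qed.

(* For [F = set0] this is the universality of the Rado graph. *)
Lemma rado_universal (U : Type) (V : set U) (adj : U -> U -> Prop) F
    (N : U -> set T) :
  countable V -> (forall u, ~ adj u u) -> (forall u v, adj u v -> adj v u) ->
  finite_set F -> (forall u, V u -> N u `<=` F) ->
  exists x : U -> T, [/\ forall u, V u -> ext_set sim F (N u) (x u),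
    {in V &, injective x} &
    {in V &, forall u v, sim (x u) (x v) <-> adj u v}].
Proof.
move=> /pfcard_geP[->|[e]] irrefl sym finF NF.
  by have [v _] := rado_nonempty; exists (fun=> v); split=> // u; rewrite inE.
have [||n|y [yext yI yE]] := rado_universal_nat (N := N \o e)
    (adj := fun i j => adj (e i) (e j)) _ _ finF.
- by move=> i; exact: irrefl.
- by move=> i j; exact: sym.
- by apply: NF; exact: 'funS_e.
have /choice[code codeK] u : exists n, V u -> e n = u.
  have [/('surj_e)[n _ <-]|nVu] := pselect (V u); first by exists n.
  by exists 0.
exists (y \o code); split=> [u Vu|u v|u v].
- by have := yext (code u); rewrite /= codeK.
- by rewrite !inE => Vu Vv /yI codeE; rewrite -(codeK u) // codeE codeK.
- by rewrite !inE => Vu Vv /=; rewrite yE !codeK.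
Qed.

Lemma rado_twins F : finite_set F -> exists x, twins sim F x.
Proof.
move=> finF.
pose V : set (set T * T) := [set K | K `<=` F] `*` setT.
have countV : countable V.
  apply: countableX (rado_countable rado).
  exact/finite_set_countable/finite_powerset.
have [||u [] //|x [xext xI xE]] :=
    rado_universal (adj := fun u v => sim u.2 v.2) (N := fst) countV _ _ finF.
- by move=> u; exact: (rado_irrefl rado).
- by move=> u v; exact: (rado_sym rado).
exists (fun K c => x (K, c)); split=> [K c KF|K K' c c' KF K'F].
  exact: (xext (K, c)).
have [VK VK'] : (K, c) \in V /\ (K', c') \in V by rewrite !inE.
by split; [move/xI => /(_ VK VK')[]|exact: xE].
Qed.

Lemma rado_refine_captured A D f F :
  D `<=` copies sim -> dense_below sim A D ->
  embedding sim f -> range f `<=` A -> finite_set F ->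
  exists2 g, refines sim F g f & captured sim D F g.
Proof.
move=> Dcopies Ddense femb fA finF.
have [x xtwin] := rado_twins finF.
have [K KF|g gemb gD] := dense_below_embeddings
    (f := fun K => f \o x K) Dcopies Ddense (finite_powerset finF).
  split; first exact/embedding_comp/(twins_embedding xtwin KF).
  by move=> _ [t _ <-]; apply/fA/imageT.
pose w := glue sim F (fun K => x K \o g).
have wemb : embedding sim w.
  by apply: glue_embedding (rado_sym rado) _; exact: twins_comp.
exists (f \o w) => [|K KF].
  split; [exact: embedding_comp| |by move=> _ [t _ <-]; exact: imageT].
  by move=> t /set_mem Ft; rewrite /= /w glue_id.
have [C DC gC] := gD K KF; exists C => // _ [u extu <-].
by apply: gC; exists u; rewrite //= /w (glue_ext _ KF extu).
Qed.

End Rado.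

Theorem theorem5p1 (T : Type) (sim : T -> T -> Prop) (A : set T)
    (D : nat -> set (set T)) :
  rado_graph sim ->
  copies sim A ->
  (forall n, D n `<=` copies sim) ->
  (forall n, dense_below sim A (D n)) ->
  dense_below sim A [set L | fusion sim D L].
Proof.
move=> rado _ Dcopies Ddense B /copies_embedding[f0 f0emb <-] f0A.
have [Ls [q [labT finF]]] := rado_labeling rado.
have [//|n g [gemb gA]|f f0E fP] := dependent_choice_inv
    (P := fun g => embedding sim g /\ range g `<=` A)
    (R := fun n g h =>
       refines sim (below Ls n) h g /\ captured sim (D n) (below Ls n) h)
    (x0 := f0).
  have [h hg hD] :=
    rado_refine_captured rado (Dcopies n) (Ddense n) gemb gA (finF n).
  by exists h => //; have [hemb _ hr] := hg; split=> //; exact: subset_trans gA.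
have f_emb n : embedding sim (f n) by have [[]] := fP n.
have [|||g gP] := @refines_limit _ sim (below Ls) f (@subset_below _ Ls).
- by rewrite bigcup_below; have [[]] := labT.
- exact: f_emb.
- by move=> n; have [_ []] := fP n.
have [gemb _ gr] := gP 0; rewrite f0E in gr.
exists (range g) => //; apply: (fusion_range labT gemb) => n.
have [_ [_ fD]] := fP n; apply: captured_refines (f_emb n.+1) _ fD.
by apply: sub_refines (gP n.+1); exact: subset_below.
Qed.
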